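(* Let $c_0$ be a proper $4$-colouring of the plane, let $\mu$ be a left-invariant finitely additive probability measure on $S_4\times E(2)$, and let $p_d$ be the associated monochromaticity probabilities (see context). Then for real $d\ge0$: (1) if $d\le\frac{\sqrt6-\sqrt2}2$, then $p_d\ge\frac1{75}$; (2) if $\frac{\sqrt6-\sqrt2}2<d\le\sqrt{\frac{14}{15}}-\frac1{\sqrt5}$, then $p_d\ge\frac{28}{2325}$; (3) if $\sqrt{\frac{14}{15}}-\frac1{\sqrt5}<d\le\frac{\sqrt{15}}4-\frac{\sqrt3}4$, then $p_d\ge\frac1{150}$; (4) if $\frac12\sqrt{5+2\sqrt3}\le d<\sqrt{\frac{19}{15}+\frac2{\sqrt5}}$, then $p_d\ge\frac1{150}$; (5) if $\sqrt{\frac{19}{15}+\frac2{\sqrt5}}\le d<\sqrt{\frac12(2+\sqrt2)(3-\sqrt3)}$, then $p_d\ge\frac{28}{2325}$; (6) if $\sqrt{\frac12(2+\sqrt2)(3-\sqrt3)}\le d\le2$, then $p_d\ge\frac1{75}$.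
   Context: Identify the plane with $\mathbb C$. A proper $4$-colouring of the plane is a map $c_0:\mathbb C\to\{1,2,3,4\}$ such that no two points at distance $1$ have the same colour. Let $S_4$ be the group of permutations of the colours and $E(2)$ the group of Euclidean isometries of the plane. The group $S_4\times E(2)$ is amenable, so there is a finitely additive probability measure $\mu$ defined on all subsets of $S_4\times E(2)$ which is left-invariant, i.e. $\mu(gE)=\mu(E)$ for all $g\in S_4\times E(2)$ and $E\subseteq S_4\times E(2)$. For $(\sigma,T)\in S_4\times E(2)$ consider the (random) colouring $c=\sigma\circ c_0\circ T^{-1}$. For $d\ge 0$, $p_d$ denotes the probability that two points $A,B$ at distance $d$ get the same colour: $p_d=\mu(\{(\sigma,T): c(A)=c(B)\})$; by left-invariance this does not depend on the choice of $A,B$ with $|AB|=d$. The existence of $c_0$ is a standing assumption, and $c_0,\mu$ are arbitrary but fixed. *)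

(* Defs.v *)
From mathcomp Require Import all_boot all_order all_algebra all_fingroup.
From mathcomp Require Import boolp classical_sets reals.
From mathcomp Require Import complex.

Set Implicit Arguments.
Unset Strict Implicit.
Unset Printing Implicit Defensive.

Import Order.TTheory GRing.Theory Num.Theory.

Local Open Scope classical_set_scope.
Local Open Scope ring_scope.

(* The library norm on [R[i]] takes its values in [R[i]]; [normc] is the same
   norm, [Num.sqrt (Re z ^+ 2 + Im z ^+ 2)], with values in [R]. *)
Definition plane_dist (R : realType) (x y : R[i]) : R :=
  ComplexField.Normc.normc (x - y).

Definition proper_coloring (R : realType) (c0 : R[i] -> 'I_4) : Prop :=
  forall x y : R[i], plane_dist x y = 1 -> c0 x <> c0 y.

(* The inverse is a field so that [T^-1] is directly available; it is
   determined by [iso_fun], so this is exactly the group E(2). *)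
Record plane_isometry (R : realType) := PlaneIsometry {
  iso_fun :> R[i] -> R[i];
  iso_inv : R[i] -> R[i];
  iso_funK : cancel iso_fun iso_inv;
  iso_invK : cancel iso_inv iso_fun;
  iso_dist : forall x y, plane_dist (iso_fun x) (iso_fun y) = plane_dist x y }.

Fact iso_comp_dist (R : realType) (S T : plane_isometry R) (x y : R[i]) :
  plane_dist ((S \o T) x) ((S \o T) y) = plane_dist x y.
Proof. by rewrite /= !iso_dist. Qed.

Definition iso_comp (R : realType) (S T : plane_isometry R) : plane_isometry R :=
  PlaneIsometry (can_comp (@iso_funK R S) (@iso_funK R T))
           (can_comp (@iso_invK R T) (@iso_invK R S)) (iso_comp_dist S T).

Definition colsym (R : realType) : Type := ('S_4 * plane_isometry R)%type.

(* Both components are composed as functions, [(s \o s', T \o T')]; the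
   library's product of permutations is [(s' * s) x = s (s' x)], hence the
   order in the first component. *)
Definition colsym_mul (R : realType) (g h : colsym R) : colsym R :=
  ((h.1 * g.1)%g, iso_comp g.2 h.2).

Definition left_invariant_probability (R : realType)
    (mu : set (colsym R) -> R) : Prop :=
  [/\ forall E, 0 <= mu E,
      mu setT = 1,
      forall E F, E `&` F = set0 -> mu (E `|` F) = mu E + mu F
    & forall g E, mu (colsym_mul g @` E) = mu E].

Definition coloring_of (R : realType) (c0 : R[i] -> 'I_4) (g : colsym R) :
    R[i] -> 'I_4 :=
  fun z => g.1 (c0 (iso_inv g.2 z)).

Definition mono_prob (R : realType) (c0 : R[i] -> 'I_4)
    (mu : set (colsym R) -> R) (A B : R[i]) : R :=
  mu [set g | coloring_of c0 g A = coloring_of c0 g B].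

(* Main.v *)
Require Import Defs.
From mathcomp Require Import all_boot all_order all_algebra all_fingroup.
From mathcomp Require Import boolp classical_sets reals.
From mathcomp Require Import complex.
From mathcomp Require Import ring lra.

Set Implicit Arguments.
Unset Strict Implicit.
Unset Printing Implicit Defensive.

Import Order.TTheory GRing.Theory Num.Theory.

Local Open Scope ring_scope.

(** Every probability p_x with x >= 1/2 is at most 1/2: an isosceles triangle with legs x and base 1
has at most one monochromatic leg.  If p_s is close to 1/2, then exactly one leg of such a triangle is
monochromatic most of the time, so that two points at distance s of O which are both at distance 1
from a third one tend to have the colour of O simultaneously.  Propagating this along a zigzag of five
points with all mutual distances >= 1/2 makes the zigzag monochromatic with probability almost 1/2;
otherwise two of its points still agree, by pigeonhole.  This contradicts the bound 1/2 for the ten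
pairs, and gives p_s <= 15/31 or p_s <= 12/25, depending on s.

On the other hand, the hexagon attached to an equilateral triangle of side d gives
p_s + p_s' >= 1 - 3 p_d for two distances s and s' determined by d, which bounds p_d from below. *)

(** * Linear inequalities under a finitely additive probability *)

Section FinitelyAdditiveProbability.
Local Open Scope classical_set_scope.
Variables (R : realType) (T : Type) (mu : set T -> R).
Hypothesis mu_ge0 : forall E, 0 <= mu E.
Hypothesis muT : mu setT = 1.
Hypothesis muU : forall E F, E `&` F = set0 -> mu (E `|` F) = mu E + mu F.

Lemma fadd_set0 : mu set0 = 0.
Proof. by have := muU (setI0 set0); rewrite setU0; lra. Qed.

Lemma fadd_split (A E : set T) : mu A = mu (A `&` E) + mu (A `\` E).
Proof.
rewrite -muU ?setUIDK //.
by apply/seteqP; split => x //= -[[_ Ex] [_ /(_ Ex)]].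
Qed.

Lemma fadd_le (E F : set T) : E `<=` F -> mu E <= mu F.
Proof.
by move=> EF; rewrite (fadd_split F E) (setIidr EF) lerDl.
Qed.

(** Integrates a pointwise bound without an integral: splitting [A] along the first set makes its
    indicator constant on each piece, so its weight moves into [c]. The bound is relative to [A]
    because the induction passes to these pieces. *)
Lemma fadd_weighted_le_in (s : seq (R * set T)) (A : set T) (c : R) :
  (forall g, A g -> \sum_(x <- s) x.1 * (`[< x.2 g >])%:R <= c) ->
  \sum_(x <- s) x.1 * mu (A `&` x.2) <= c * mu A.
Proof.
elim: s A c => [|[w E] s IHs] A c ub.
  rewrite big_nil; have [->|/set0P[g /ub]] := eqVneq A set0.
    by rewrite fadd_set0 mulr0.
  by rewrite big_nil => c_ge0; rewrite mulr_ge0.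
have ubI : \sum_(x <- s) x.1 * mu ((A `&` E) `&` x.2) <= (c - w) * mu (A `&` E).
  apply: IHs => g [Ag Eg]; move: (ub g Ag); rewrite big_cons /=.
  by rewrite (asboolT Eg) mulr1; lra.
have ubD : \sum_(x <- s) x.1 * mu ((A `\` E) `&` x.2) <= c * mu (A `\` E).
  apply: IHs => g [Ag Eg]; move: (ub g Ag); rewrite big_cons /=.
  by rewrite (asboolF Eg) mulr0 add0r.
rewrite big_cons /=.
have -> : \sum_(x <- s) x.1 * mu (A `&` x.2) =
    \sum_(x <- s) x.1 * mu ((A `&` E) `&` x.2) +
    \sum_(x <- s) x.1 * mu ((A `\` E) `&` x.2).
  rewrite -big_split /=; apply: eq_bigr => x _.
  by rewrite (fadd_split (A `&` x.2) E) setIAC setIDAC setIDA mulrDr.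
rewrite (fadd_split A E); lra.
Qed.

Lemma fadd_weighted_le (s : seq (R * set T)) (c : R) :
  (forall g, \sum_(x <- s) x.1 * (`[< x.2 g >])%:R <= c) ->
  \sum_(x <- s) x.1 * mu x.2 <= c.
Proof.
move=> ub; have := @fadd_weighted_le_in s setT c (fun g _ => ub g).
by rewrite muT mulr1; under eq_bigr do rewrite setTI.
Qed.

End FinitelyAdditiveProbability.

(** * Inequalities between four colours, by enumeration *)

Section FourColors.
Local Open Scope nat_scope.

Lemma all_iota_ord (n : nat) (P : pred nat) (i : 'I_n) :
  all P (iota 0 n) -> P i.
Proof. by move/allP; apply; rewrite mem_iota /=. Qed.

Lemma hexagon_colors (p q x y z : 'I_4) :
  y <> p -> y <> q -> z <> q -> z <> x -> y <> z ->
  (1 <= (y == x) + ((z == p) + ((p == q) + ((q == x) + (x == p))))).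
Proof.
have : all (fun p : nat => all (fun q : nat =>
    all (fun x : nat => all (fun y : nat => all (fun z : nat =>
    [|| y == p, y == q, z == q, z == x, y == z |
      1 <= (y == x) + ((z == p) + ((p == q) + ((q == x) + (x == p))))])
  (iota 0 4)) (iota 0 4)) (iota 0 4)) (iota 0 4)) (iota 0 4) by vm_compute.
move=> /(all_iota_ord p) /(all_iota_ord q) /(all_iota_ord x) /(all_iota_ord y).
move=> /(all_iota_ord z); rewrite !val_eqE.
by do 5![case: eqP => // _].
Qed.

Lemma zigzag_colors (z0 z1 z2 z3 z4 m1 m2 m3 : 'I_4) :
  m1 <> z0 -> m1 <> z2 -> m2 <> z1 -> m2 <> z3 -> m3 <> z2 -> m3 <> z4 ->
  (3 * (z0 == z1) + 6 * (z1 == z2) + 6 * (z2 == z3) + 3 * (z3 == z4) +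
     4 * (z1 == m1) + 5 * (z2 == m2) + 4 * (z3 == m3) <=
   12 + (z0 == z2) + (z0 == z3) + (z0 == z4) + (z1 == z3) + (z1 == z4) +
     (z2 == z4)).
Proof.
(* If [mi] has the colour of [zi], then [zi] differs from both neighbours. Replacing each [zi == mi]
   by that condition eliminates the [mi], leaving 4^5 cases. *)
have : all (fun z0 : nat => all (fun z1 : nat =>
    all (fun z2 : nat => all (fun z3 : nat => all (fun z4 : nat =>
    3 * (z0 == z1) + 6 * (z1 == z2) + 6 * (z2 == z3) + 3 * (z3 == z4) +
     4 * ((z1 != z0) && (z1 != z2)) + 5 * ((z2 != z1) && (z2 != z3)) +
     4 * ((z3 != z2) && (z3 != z4)) <=
   12 + (z0 == z2) + (z0 == z3) + (z0 == z4) + (z1 == z3) + (z1 == z4) +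
     (z2 == z4))
  (iota 0 4)) (iota 0 4)) (iota 0 4)) (iota 0 4)) (iota 0 4) by vm_compute.
move=> /(all_iota_ord z0) /(all_iota_ord z1) /(all_iota_ord z2).
move=> /(all_iota_ord z3) /(all_iota_ord z4); rewrite !val_eqE => le12.
move=> /eqP m10 /eqP m12 /eqP m21 /eqP m23 /eqP m32 /eqP m34.
apply: leq_trans le12.
have mid (m z z' z'' : 'I_4) : m != z' -> m != z'' ->
    ((z == m) <= (z != z') && (z != z'')).
  by move=> mz' mz''; case: eqVneq => // ->; rewrite mz' mz''.
by rewrite !leq_add ?leq_mul ?mid.
Qed.

End FourColors.

(** * Distances and isometries of the plane *)

Section Plane.
Variable R : realType.
Implicit Types (x y z : R[i]) (a b c d v : R).

Lemma plane_distC x y : plane_dist x y = plane_dist y x.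
Proof. by rewrite /plane_dist -opprB normcN. Qed.

Lemma plane_distE a b c d v : 0 <= v ->
  (a - c) ^+ 2 + (b - d) ^+ 2 = v ^+ 2 ->
  plane_dist (a +i* b)%C (c +i* d)%C = v.
Proof.
by move=> v_ge0 E; rewrite /plane_dist /= E sqrtr_sqr ger0_norm.
Qed.

Lemma similarity_dist (u p q x y : R[i]) : ComplexField.Normc.normc u = 1 ->
  plane_dist (q + u * (x - p)) (q + u * (y - p)) = plane_dist x y.
Proof.
move=> u1; rewrite /plane_dist.
have -> : q + u * (x - p) - (q + u * (y - p)) = u * (x - y) by ring.
by rewrite ComplexField.Normc.normcM u1 mul1r.
Qed.

Lemma similarityK (u p q : R[i]) : u != 0 ->
  cancel (fun x => q + u * (x - p)) (fun x => p + u^-1 * (x - q)).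
Proof. by move=> u0 x /=; rewrite addrAC subrr add0r mulKf // addrC subrK. Qed.

Lemma plane_isometry_transitive (A B A' B' : R[i]) :
  plane_dist A B = plane_dist A' B' ->
  exists T : plane_isometry R, iso_inv T A' = A /\ iso_inv T B' = B.
Proof.
move=> eqd.
(* [u] is the rotation factor [(B' - A') / (B - A)]. When the points coincide this quotient is 0,
   which is not unimodular, so 1 is taken instead. *)
have [u [u1 uE]] : exists u : R[i],
    ComplexField.Normc.normc u = 1 /\ B' - A' = u * (B - A).
  have [AB|AB] := eqVneq A B.
    exists 1; split; first exact: ComplexField.Normc.normc1.
    move: eqd; rewrite AB /plane_dist !subrr ComplexField.Normc.normc0 mulr0.
    by move/esym/ComplexField.Normc.eq0_normc/eqP; rewrite subr_eq0 => /eqP ->; rewrite subrr.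
  have BA0 : B - A != 0 by rewrite subr_eq0 eq_sym.
  exists ((B' - A') / (B - A)); split; last by rewrite divfK.
  rewrite ComplexField.Normc.normcM ComplexField.Normc.normcV.
  move: eqd; rewrite plane_distC (plane_distC A') /plane_dist => <-.
  by rewrite divff //; apply: contra BA0 => /eqP/ComplexField.Normc.eq0_normc ->.
have u0 : u != 0.
  apply/eqP => u0; move: u1; rewrite u0 ComplexField.Normc.normc0 => /eqP.
  by rewrite eq_sym oner_eq0.
have uVK : cancel (fun x => A + u^-1 * (x - A')) (fun x => A' + u * (x - A)).
  by move=> x; rewrite addrAC subrr add0r mulVKf // addrC subrK.
exists (PlaneIsometry (@similarityK u A A' u0) uVK
  (fun x y => similarity_dist A A' x y u1)) => /=.
by rewrite subrr mulr0 addr0 uE mulKf // addrC subrK.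
Qed.

End Plane.

(** * Bounds on the monochromaticity probabilities *)

Section MonochromaticityProbability.
Variables (R : realType) (c0 : R[i] -> 'I_4) (mu : set (colsym R) -> R).
Hypothesis c0_proper : proper_coloring c0.
Hypothesis mu_inv : left_invariant_probability mu.
Local Notation prob := (mono_prob c0 mu).

Lemma coloring_of_proper (g : colsym R) : proper_coloring (coloring_of c0 g).
Proof.
move=> x y xy1 /perm_inj; apply: c0_proper.
by rewrite -(iso_dist g.2) !iso_invK.
Qed.

(** Left translation by [(1, T)], where [T] carries A to A' and B to B', maps the first event into
    the second. Exchanging the pairs gives equality. *)
Lemma mono_prob_le_dist (A B A' B' : R[i]) :
  plane_dist A B = plane_dist A' B' -> prob A B <= prob A' B'.
Proof.
case: mu_inv => mu_ge0 _ muU mu_mul /plane_isometry_transitive[T [TA TB]].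
rewrite /mono_prob -(mu_mul (1%g, T)); apply: fadd_le => //.
move=> _ [g /= gAB <-]; rewrite /coloring_of /= TA TB !permM.
by move: gAB; rewrite /coloring_of => /= ->.
Qed.

Definition mono_at (d : R) : R := prob 0 (d +i* 0)%C.

Lemma mono_probE (A B : R[i]) (d : R) : 0 <= d -> plane_dist A B = d ->
  prob A B = mono_at d.
Proof.
move=> d_ge0 ABd.
have dE : plane_dist 0 (d +i* 0)%C = d by apply: plane_distE => //; ring.
by apply/eqP; rewrite eq_le /mono_at !mono_prob_le_dist // ABd dE.
Qed.

(** Reduces inequalities between probabilities to combinatorics of a single proper colouring.
    Weights may be negative, so lower bounds are covered too. *)
Lemma mono_weighted_le (s : seq (R * (R[i] * R[i]))) (k : R) :
  (forall c : R[i] -> 'I_4, proper_coloring c ->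
     \sum_(e <- s) e.1 * (c e.2.1 == c e.2.2)%:R <= k) ->
  \sum_(e <- s) e.1 * prob e.2.1 e.2.2 <= k.
Proof.
case: mu_inv => mu_ge0 muT muU _ ub.
pose ev (e : R * (R[i] * R[i])) : R * set (colsym R) :=
  (e.1, [set g | coloring_of c0 g e.2.1 = coloring_of c0 g e.2.2])%classic.
have := @fadd_weighted_le _ _ _ mu_ge0 muT muU (map ev s) k.
rewrite big_map; apply => g; rewrite big_map.
have := ub _ (@coloring_of_proper g).
congr (_ <= _); apply: eq_bigr => e _; congr (_ * _%:R).
by rewrite /ev /=; congr nat_of_bool; apply/eqP/asboolP.
Qed.

Lemma mono_at_le_half (x : R) : 1 / 2 <= x -> mono_at x <= 1 / 2.
Proof.
move=> x_ge; have x_ge0 : 0 <= x by lra.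
(* [y] is the height of the isosceles triangle with legs [x] and base 1. *)
have [y yE] : exists y, y ^+ 2 = x ^+ 2 - 1 / 4.
  by exists (Num.sqrt (x ^+ 2 - 1 / 4)); rewrite sqr_sqrtr //; nra.
pose O : R[i] := (0 +i* 0)%C.
pose A : R[i] := (1 / 2 +i* y)%C.
pose B : R[i] := (- (1 / 2) +i* y)%C.
have := @mono_weighted_le [:: (1, (O, A)); (1, (O, B))] 1.
rewrite !big_cons !big_nil /=.
have OA : prob O A = mono_at x.
  by apply: mono_probE => //; apply: plane_distE => //; lra.
have OB : prob O B = mono_at x.
  by apply: mono_probE => //; apply: plane_distE => //; lra.
rewrite OA OB; move=> H; suff : 1 * mono_at x + (1 * mono_at x + 0) <= 1 by lra.
apply: H => c c_proper; rewrite !big_cons !big_nil /=.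
have AB : c A <> c B by apply: c_proper; apply: plane_distE => //; field.
have : ((c O == c A) + (c O == c B) <= 1)%N.
  by case: eqVneq => [->|_]; [case: eqP | rewrite leq_b1].
by rewrite -(ler_nat R) natrD; lra.
Qed.

(* Let PQX be a triangle of side d. The points at distance 1 from two of its vertices form a hexagon
   of side 1, and Y and Z are adjacent in it. If PQX is rainbow, then Y has the colour of X or the
   fourth one, Z has the colour of P or the fourth one, and not both have the fourth one. *)
Lemma mono_at_hexagon (d t r : R) : 0 <= d -> 0 <= t -> 0 <= r ->
  t ^+ 2 = 3 -> r ^+ 2 = 1 - d ^+ 2 / 4 ->
  1 - 3 * mono_at d <=
  mono_at `|r - t / 2 * d| + mono_at (r + t / 2 * d).
Proof.
move=> d_ge0 t_ge0 r_ge0 tE rE.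
have [e dE] : exists e, d = 2 * e by exists (d / 2); field.
have {}rE : r ^+ 2 = 1 - e ^+ 2 by rewrite rE dE; field.
(* [Y] lies at height [r] above the midpoint of PQ, on the side of X; [Z] lies at distance [r] from
   the midpoint of QX, away from P. Hence YX and ZP lie along altitudes, whose length is
   [t / 2 * d]. *)
pose P : R[i] := (- e +i* 0)%C.
pose Q : R[i] := (e +i* 0)%C.
pose X : R[i] := (0 +i* (t * e))%C.
pose Y : R[i] := (0 +i* r)%C.
pose Z : R[i] := ((e + t * r) / 2 +i* ((t * e + r) / 2))%C.
have sE : prob Y X = mono_at `|r - t / 2 * d|.
  apply: mono_probE => //; apply: plane_distE => //.
  by rewrite real_normK ?num_real // dE; field.
have s'_ge0 : 0 <= r + t / 2 * d by have := mulr_ge0 t_ge0 d_ge0; lra.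
have s'E : prob Z P = mono_at (r + t / 2 * d).
  by apply: mono_probE => //; apply: plane_distE => //; rewrite dE; field: tE.
have PQ : prob P Q = mono_at d.
  by apply: mono_probE => //; apply: plane_distE => //; rewrite dE; field.
have QX : prob Q X = mono_at d.
  by apply: mono_probE => //; apply: plane_distE => //; rewrite dE; field: tE.
have XP : prob X P = mono_at d.
  by apply: mono_probE => //; apply: plane_distE => //; rewrite dE; field: tE.
have := @mono_weighted_le [:: (-1, (Y, X)); (-1, (Z, P)); (-1, (P, Q));
  (-1, (Q, X)); (-1, (X, P))] (-1).
rewrite !big_cons !big_nil /= sE s'E PQ QX XP.
set p := mono_at d => H.
suff : -1 * mono_at `|r - t / 2 * d| + (-1 * mono_at (r + t / 2 * d) +
    (-1 * p + (-1 * p + (-1 * p + 0)))) <= -1 by lra.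
apply: H => c c_proper; rewrite !big_cons !big_nil /=.
have YP : c Y <> c P by apply: c_proper; apply: plane_distE => //; field: rE.
have YQ : c Y <> c Q by apply: c_proper; apply: plane_distE => //; field: rE.
have ZQ : c Z <> c Q by apply: c_proper; apply: plane_distE => //; field: rE tE.
have ZX : c Z <> c X by apply: c_proper; apply: plane_distE => //; field: rE tE.
have YZ : c Y <> c Z by apply: c_proper; apply: plane_distE => //; field: rE tE.
have : ((c Y == c X) + ((c Z == c P) + ((c P == c Q) + ((c Q == c X) + (c X == c P))))  >= 1)%N.
  exact: hexagon_colors.
rewrite -(ler_nat R) !natrD; lra.
Qed.

(* The consecutive distances of z0, ..., z4 are s, and mi is at distance s from zi and 1 from both
   neighbours of zi. The weights are an optimal dual solution of the linear program that maximises
   p_s subject to the constraints p <= 1/2 on the other pairs. *)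
Lemma mono_at_zigzag (s w x : R) : 0 < s -> 0 <= w -> 0 <= x ->
  w ^+ 2 = 4 - s ^- 2 -> x ^+ 2 = s ^+ 2 + 2 * w ^+ 2 ->
  31 * mono_at s <= 12 + 3 * mono_at w + 2 * mono_at x + mono_at (2 * w).
Proof.
move=> s_gt0 w_ge0 x_ge0 wE xE; have s_ge0 := ltW s_gt0.
have [k kE skE] : exists2 k, w ^+ 2 = 4 - k ^+ 2 & s * k = 1.
  by exists s^-1; rewrite ?divff ?gt_eqF // wE exprVn.
have {}xE : x ^+ 2 = s ^+ 2 + 2 * (4 - k ^+ 2) by rewrite xE kE.
(* The points [z0], [m1], [z2] lie on the circle of radius [s] about [z1], consecutive ones at
   distance 1; the chord spanning both steps is [w]. The same figure, alternately reflected, recurs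
   at [z2] and [z3]. *)
pose z0 : R[i] := (0 +i* 0)%C.
pose z1 : R[i] := (w / 2 +i* (s - k / 2))%C.
pose z2 : R[i] := (w +i* 0)%C.
pose z3 : R[i] := (3 * w / 2 +i* (s - k / 2))%C.
pose z4 : R[i] := (2 * w +i* 0)%C.
pose m1 : R[i] := (w / 2 +i* (- (k / 2)))%C.
pose m2 : R[i] := (w +i* s)%C.
pose m3 : R[i] := (3 * w / 2 +i* (- (k / 2)))%C.
have z01 : prob z0 z1 = mono_at s.
  by apply: mono_probE => //; apply: plane_distE => //; field: kE skE.
have z12 : prob z1 z2 = mono_at s.
  by apply: mono_probE => //; apply: plane_distE => //; field: kE skE.
have z23 : prob z2 z3 = mono_at s.
  by apply: mono_probE => //; apply: plane_distE => //; field: kE skE.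
have z34 : prob z3 z4 = mono_at s.
  by apply: mono_probE => //; apply: plane_distE => //; field: kE skE.
have z1m : prob z1 m1 = mono_at s.
  by apply: mono_probE => //; apply: plane_distE => //; field.
have z2m : prob z2 m2 = mono_at s.
  by apply: mono_probE => //; apply: plane_distE => //; field.
have z3m : prob z3 m3 = mono_at s.
  by apply: mono_probE => //; apply: plane_distE => //; field.
have z02 : prob z0 z2 = mono_at w.
  by apply: mono_probE => //; apply: plane_distE => //; field.
have z13 : prob z1 z3 = mono_at w.
  by apply: mono_probE => //; apply: plane_distE => //; field.
have z24 : prob z2 z4 = mono_at w.
  by apply: mono_probE => //; apply: plane_distE => //; field.
have z03 : prob z0 z3 = mono_at x.
  by apply: mono_probE => //; apply: plane_distE => //; field: xE kE skE.
have z14 : prob z1 z4 = mono_at x.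
  by apply: mono_probE => //; apply: plane_distE => //; field: xE kE skE.
have z04 : prob z0 z4 = mono_at (2 * w).
  apply: mono_probE; first by rewrite mulr_ge0.
  by apply: plane_distE; [rewrite mulr_ge0 | field].
have := @mono_weighted_le [:: (3, (z0, z1)); (6, (z1, z2)); (6, (z2, z3));
  (3, (z3, z4)); (4, (z1, m1)); (5, (z2, m2)); (4, (z3, m3)); (-1, (z0, z2));
  (-1, (z0, z3)); (-1, (z0, z4)); (-1, (z1, z3)); (-1, (z1, z4));
  (-1, (z2, z4))] 12.
rewrite !big_cons !big_nil z01 z12 z23 z34 z1m z2m z3m z02 z13 z24 z03 z14 z04.
set ps := mono_at s; set pw := mono_at w; set px := mono_at x.
set p2w := mono_at (2 * w) => /= H.
apply: (@le_trans _ _ (31 * ps + (12 - 12))); first lra.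
suff K : 31 * ps - 3 * pw - 2 * px - p2w <= 12 by lra.
apply: le_trans (H _); first lra.
move=> {H} c c_proper; rewrite !big_cons !big_nil /=.
have unit_dist (a b a' b' : R) : (a - a') ^+ 2 + (b - b') ^+ 2 = 1 ->
    c (a +i* b)%C <> c (a' +i* b')%C.
  by move=> d1; apply: c_proper; apply: plane_distE; rewrite ?expr1n.
have m10 : c m1 <> c z0 by apply: unit_dist; field: kE.
have m12 : c m1 <> c z2 by apply: unit_dist; field: kE.
have m21 : c m2 <> c z1 by apply: unit_dist; field: kE.
have m23 : c m2 <> c z3 by apply: unit_dist; field: kE.
have m32 : c m3 <> c z2 by apply: unit_dist; field: kE.
have m34 : c m3 <> c z4 by apply: unit_dist; field: kE.
have := zigzag_colors m10 m12 m21 m23 m32 m34.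
rewrite -(ler_nat R) !natrD; lra.
Qed.

Lemma mono_at_le1 (x : R) : mono_at x <= 1.
Proof. by case: mu_inv => mu_ge0 <- muU _; apply: fadd_le. Qed.

(** The other zigzag distances are [v], [x] and [2 * v], with [v >= w] and [x >= s >= w]; their
    weights 3, 2 and 1 add up to 6. *)
Lemma mono_at_zigzag_ub (s w u : R) : 0 < w -> 0 < s ->
  w ^+ 2 <= 4 - s ^- 2 -> w <= s ->
  (forall y, w <= y -> mono_at y <= u) -> 31 * mono_at s <= 12 + 6 * u.
Proof.
move=> w_gt0 s_gt0 w_le ws ub.
pose v := Num.sqrt (4 - s ^- 2); pose x := Num.sqrt (s ^+ 2 + 2 * v ^+ 2).
have w2_ge0 := sqr_ge0 w.
have v_ge0 : 0 <= v by apply: sqrtr_ge0.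
have x_ge0 : 0 <= x by apply: sqrtr_ge0.
have vE : v ^+ 2 = 4 - s ^- 2 by rewrite sqr_sqrtr //; lra.
have xE : x ^+ 2 = s ^+ 2 + 2 * v ^+ 2.
  by rewrite sqr_sqrtr //; have := sqr_ge0 s; have := sqr_ge0 v; lra.
have wv : w <= v by rewrite -(ler_sqr (ltW w_gt0)) ?nnegrE // vE.
have sx : s <= x by rewrite -(ler_sqr (ltW s_gt0)) ?nnegrE // xE; nra.
have := mono_at_zigzag s_gt0 v_ge0 x_ge0 vE xE.
have := ub _ wv; have := ub x (le_trans ws sx).
have : mono_at (2 * v) <= u by apply: ub; lra.
lra.
Qed.

(** 4/15 is the value of [s ^+ 2] at which [4 - s ^- 2] equals 1/4, so that all zigzag distances are
    at least 1/2. *)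
Lemma mono_at_le_15_31 (s : R) : 4 / 15 <= s ^+ 2 -> 0 <= s -> mono_at s <= 15 / 31.
Proof.
move=> s2 s_ge0; have s_gt : 1 / 2 < s by nra.
have sV : s ^- 2 <= 15 / 4.
  by rewrite -[leLHS]mul1r ler_pdivrMr; [lra | rewrite exprn_gt0; lra].
have := @mono_at_zigzag_ub s (1 / 2) (1 / 2) _ _ _ _ mono_at_le_half.
by move=> /(_ ltac:(lra) ltac:(lra) ltac:(lra) ltac:(lra)); lra.
Qed.

(* The equation says that l is a fixed point of the increasing map s |-> sqrt (4 - s^-2), so that all
   distances of the zigzag are at least l; hence the supremum T of p over [l, +oo[ satisfies
   31 T <= 12 + 6 T. *)
Lemma mono_at_le_12_25 (l s : R) : 0 < l -> l ^+ 4 - 4 * l ^+ 2 + 1 = 0 ->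
  l <= s -> mono_at s <= 12 / 25.
Proof.
move=> l_gt0 lE ls.
pose E : set R := [set mono_at y | y in [set y | l <= y]]%classic.
have ubE : has_ubound E by exists 1 => _ [y _ <-]; apply: mono_at_le1.
have ub y : l <= y -> mono_at y <= sup E by move=> ly; apply: ub_le_sup => //; exists y.
have sup_le : sup E <= (12 + 6 * sup E) / 31.
  apply: ge_sup; first by exists (mono_at s), s.
  move=> _ [y /= ly <-]; have y_gt0 := lt_le_trans l_gt0 ly.
  suff : 31 * mono_at y <= 12 + 6 * sup E by lra.
  apply: (mono_at_zigzag_ub l_gt0 y_gt0) => //.
  have : y ^- 2 <= l ^- 2 by rewrite lef_pV2 ?posrE ?exprn_gt0 // ler_sqr ?nnegrE // ltW.
  suff -> : l ^- 2 = 4 - l ^+ 2 by lra.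
  apply: (mulfI (x := l ^+ 2)); first by rewrite expf_neq0 ?gt_eqF.
  by rewrite divff ?expf_neq0 ?gt_eqF //; lra.
have := ub s ls; lra.
Qed.

End MonochromaticityProbability.

(** * From the bounds to the six ranges of d *)

Lemma sqrt_le_sqr (R : realType) (x d : R) : Num.sqrt x <= d -> x <= d ^+ 2.
Proof.
move=> xd; have sx_ge0 := sqrtr_ge0 x; have d2 := sqr_ge0 d.
(* For negative [x] the root is 0 by convention, and the claim is trivial. *)
have [x_ge0|x_lt0] := leP 0 x; last lra.
by rewrite -[leLHS]sqr_sqrtr // ler_sqr ?nnegrE // (le_trans sx_ge0).
Qed.

Lemma lt_sqrt_sqr (R : realType) (x d : R) :
  0 <= d -> d < Num.sqrt x -> d ^+ 2 < x.
Proof.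
move=> d_ge0 dx; have : 0 < Num.sqrt x by apply: le_lt_trans dx.
rewrite sqrtr_gt0 => /ltW x_ge0.
by rewrite -[ltRHS]sqr_sqrtr // ltr_sqr ?nnegrE ?sqrtr_ge0.
Qed.

Theorem mainTheorem8 (R : realType) (c0 : R[i] -> 'I_4)
    (mu : set (colsym R) -> R)
    (c0_proper : proper_coloring c0)
    (mu_inv : left_invariant_probability mu)
    (d : R) (d_ge0 : 0 <= d) (A B : R[i]) (dAB : plane_dist A B = d) :
  (d <= (Num.sqrt 6 - Num.sqrt 2) / 2 ->
     1 / 75 <= mono_prob c0 mu A B) /\
  ((Num.sqrt 6 - Num.sqrt 2) / 2 < d ->
     d <= Num.sqrt (14 / 15) - 1 / Num.sqrt 5 ->
     28 / 2325 <= mono_prob c0 mu A B) /\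
  (Num.sqrt (14 / 15) - 1 / Num.sqrt 5 < d ->
     d <= Num.sqrt 15 / 4 - Num.sqrt 3 / 4 ->
     1 / 150 <= mono_prob c0 mu A B) /\
  (1 / 2 * Num.sqrt (5 + 2 * Num.sqrt 3) <= d ->
     d < Num.sqrt (19 / 15 + 2 / Num.sqrt 5) ->
     1 / 150 <= mono_prob c0 mu A B) /\
  (Num.sqrt (19 / 15 + 2 / Num.sqrt 5) <= d ->
     d < Num.sqrt (1 / 2 * (2 + Num.sqrt 2) * (3 - Num.sqrt 3)) ->
     28 / 2325 <= mono_prob c0 mu A B) /\
  (Num.sqrt (1 / 2 * (2 + Num.sqrt 2) * (3 - Num.sqrt 3)) <= d ->
     d <= 2 ->
     1 / 75 <= mono_prob c0 mu A B).
Proof.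
rewrite (mono_probE c0 mu_inv d_ge0 dAB); set p := mono_at c0 mu.
set a := Num.sqrt 2; set t := Num.sqrt 3; set q := 1 / Num.sqrt 5.
have a_ge0 : 0 <= a by apply: sqrtr_ge0.
have t_ge0 : 0 <= t by apply: sqrtr_ge0.
have q_ge0 : 0 <= q by rewrite divr_ge0 // sqrtr_ge0.
have aE : a ^+ 2 = 2 by rewrite sqr_sqrtr.
have tE : t ^+ 2 = 3 by rewrite sqr_sqrtr.
have qE : q ^+ 2 = 1 / 5 by rewrite expr_div_n expr1n sqr_sqrtr.
have a_lo : 14 / 10 <= a by nra.
have a_hi : a <= 15 / 10 by nra.
have t_lo : 17 / 10 <= t by nra.
have t_hi : t <= 174 / 100 by nra.
have q_lo : 4 / 10 <= q by nra.
have q_hi : q <= 5 / 10 by nra.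
have q2 : 2 / Num.sqrt 5 = 2 * q by rewrite /q mul1r.
have l_def : (Num.sqrt 6 - a) / 2 = a * (t - 1) / 2.
  have -> : 6 = 2 * 3 :> R by rewrite -natrM.
  by rewrite sqrtrM // -/a -/t mulrBr mulr1.
(* This [l] is the fixed point required by [mono_at_le_12_25]: its square [2 - t] is a root of X^2 -
   4 X + 1. *)
rewrite l_def q2; set l := a * (t - 1) / 2.
have l_gt0 : 0 < l by rewrite /l; nra.
have lE : l ^+ 2 = 2 - t by rewrite /l; field: aE tE.
have tlE : t * l = a - l by rewrite /l; field: tE.
have alE : a * l = t - 1 by rewrite /l; field: aE.
have l4E : l ^+ 4 - 4 * l ^+ 2 + 1 = 0 by rewrite (exprM l 2 2) lE; ring: tE.
have p_l y : l <= y -> p y <= 12 / 25 by apply: mono_at_le_12_25.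
have hexagon (s u : R) : d <= 2 -> (forall y, s <= y -> p y <= u) ->
    (forall r, 0 <= r -> r ^+ 2 = 1 - d ^+ 2 / 4 -> s <= `|r - t / 2 * d|) ->
    1 - (u + 12 / 25) <= 3 * p d.
  move=> d_le2 p_s s_le.
  pose r := Num.sqrt (1 - d ^+ 2 / 4).
  have r_ge0 : 0 <= r by apply: sqrtr_ge0.
  have rE : r ^+ 2 = 1 - d ^+ 2 / 4 by rewrite sqr_sqrtr //; nra.
  have := mono_at_hexagon c0_proper mu_inv d_ge0 t_ge0 r_ge0 tE rE.
  have := p_s _ (s_le r r_ge0 rE).
  (* The larger hexagon distance has square 1 + t d r + d^2 / 2, so it is at least 1, hence at least
     [l]. *)
  have : p (r + t / 2 * d) <= 12 / 25.
    have s'_ge0 : 0 <= r + t / 2 * d by have := mulr_ge0 t_ge0 d_ge0; lra.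
    apply: p_l; apply: (@le_trans _ _ 1); first nra.
    rewrite -ler_sqr ?nnegrE // expr1n.
    have -> : (r + t / 2 * d) ^+ 2 = r ^+ 2 + t * d * r + 3 / 4 * d ^+ 2.
      by field: tE.
    have : 0 <= t * d * r by rewrite !mulr_ge0.
    by have := sqr_ge0 d; rewrite rE; lra.
  by rewrite -/p; lra.
(* The quadratic condition is [s + t / 2 * d <= r] after squaring. *)
have small (s u : R) : 0 <= s -> s ^+ 2 + t * s * d + d ^+ 2 <= 1 ->
    (forall y, s <= y -> p y <= u) -> 1 - (u + 12 / 25) <= 3 * p d.
  move=> s_ge0 s_small p_s.
  have tsd_ge0 : 0 <= t * s * d by rewrite !mulr_ge0.
  apply: hexagon p_s _; first by nra.
  move=> r r_ge0 rE; rewrite (le_trans _ (ler_norm _)) // lerBrDr.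
  have td_ge0 : 0 <= t / 2 * d by have := mulr_ge0 t_ge0 d_ge0; lra.
  rewrite -ler_sqr ?nnegrE ?addr_ge0 // rE.
  have -> : (s + t / 2 * d) ^+ 2 = s ^+ 2 + t * s * d + 3 / 4 * d ^+ 2.
    by field: tE.
  lra.
(* Here the smaller distance is [t / 2 * d - r]. Squaring turns the requirement that it be at least
   [l] into [(d - a) * (d + l) >= 0], whence the threshold [a], the root of 2. *)
have large : 2 <= d ^+ 2 -> d <= 2 -> 1 / 75 <= p d.
  move=> d2_ge2 d_le2.
  suff : 1 - (12 / 25 + 12 / 25) <= 3 * p d by lra.
  apply: hexagon p_l _ => // r r_ge0 rE.
  rewrite -normrN opprB (le_trans _ (ler_norm _)) // lerBrDr -lerBrDl.
  have a_le_d : a <= d by rewrite -ler_sqr ?nnegrE // aE.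
  have ld_ge0 : 0 <= t / 2 * d - l by nra.
  rewrite -ler_sqr ?nnegrE // rE.
  have -> : (t / 2 * d - l) ^+ 2 = 3 / 4 * d ^+ 2 - (t * l) * d + l ^+ 2.
    by field: tE.
  have : 0 <= (d - a) * (d + l) by rewrite mulr_ge0; lra.
  have -> : (d - a) * (d + l) = d ^+ 2 - (a - l) * d - a * l by ring.
  rewrite alE tlE lE; lra.
split=> [d_le|]; last split=> [_ d_le|]; last split=> [_ d_le|];
  last split=> [d_ge d_lt|]; last split=> [d_ge d_lt|d_ge d_le].
(* At [d = l = s] the quadratic form is (2 + t) l^2 = (2 + t) (2 - t) = 1. *)
- suff : 1 - (12 / 25 + 12 / 25) <= 3 * p d by lra.
  apply: small p_l; first exact: ltW.
  have : t * l * d <= t * l * l by rewrite ler_wpM2l // mulr_ge0 // ltW.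
  have : d ^+ 2 <= l ^+ 2 by rewrite ler_sqr ?nnegrE // ltW.
  have -> : t * l * l = t * l ^+ 2 by ring.
  by rewrite lE mulrBr -expr2 tE; lra.
- suff : 1 - (15 / 31 + 12 / 25) <= 3 * p d by lra.
  (* This [s] is the threshold of [mono_at_le_15_31]; the quadratic form becomes (d + q)^2 +
     1/15. *)
  have sE : (2 * q * t / 3) ^+ 2 = 4 / 15.
    have -> : (2 * q * t / 3) ^+ 2 = 4 / 9 * q ^+ 2 * t ^+ 2 by field.
    by rewrite qE tE; field.
  have s_ge0 : 0 <= 2 * q * t / 3 by have := mulr_ge0 q_ge0 t_ge0; lra.
  apply: (small (2 * q * t / 3)) => [//| |y sy]; last first.
    apply: mono_at_le_15_31 => //; last by lra.
    by rewrite -sE ler_sqr ?nnegrE // (le_trans s_ge0).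
  have : (d + q) ^+ 2 <= 14 / 15.
    have dq : d + q <= Num.sqrt (14 / 15) by lra.
    have <- : Num.sqrt (14 / 15) ^+ 2 = 14 / 15 :> R by rewrite sqr_sqrtr //; lra.
    by rewrite ler_sqr ?nnegrE ?sqrtr_ge0 ?addr_ge0.
  have -> : t * (2 * q * t / 3) = 2 * q by field: tE.
  by rewrite sE sqrrD qE; lra.
- suff : 1 - (1 / 2 + 12 / 25) <= 3 * p d by lra.
  (* With [s = 1 / 2] the quadratic form is (d + t / 4)^2 + 1/16. *)
  apply: (small (1 / 2)); [lra | | by move=> y; apply: mono_at_le_half].
  have : (d + t / 4) ^+ 2 <= 15 / 16.
    have dt : d + t / 4 <= Num.sqrt 15 / 4 by lra.
    have <- : (Num.sqrt 15 / 4) ^+ 2 = 15 / 16 :> R.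
      by rewrite expr_div_n sqr_sqrtr //; field.
    by rewrite ler_sqr ?nnegrE ?addr_ge0 ?divr_ge0 ?sqrtr_ge0.
  have -> : (d + t / 4) ^+ 2 = d ^+ 2 + t * (1 / 2) * d + 3 / 16 by field: tE.
  lra.
(* The three remaining ranges all lie between the root of 2 and 2, where [large] gives 1/75, at
   least the bound claimed in each. *)
- have d2_ge : 5 + 2 * t <= (2 * d) ^+ 2 by apply: sqrt_le_sqr; lra.
  have d2_lt := lt_sqrt_sqr d_ge0 d_lt.
  have := large; suff [-> ->] : 2 <= d ^+ 2 /\ d <= 2
    by move=> /(_ isT isT); lra.
  by split; [|rewrite -ler_sqr ?nnegrE //]; nra.
- have d2_ge := sqrt_le_sqr d_ge.
  have d2_lt := lt_sqrt_sqr d_ge0 d_lt.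
  have := large; suff [-> ->] : 2 <= d ^+ 2 /\ d <= 2
    by move=> /(_ isT isT); lra.
  by split; [|rewrite -ler_sqr ?nnegrE //]; nra.
- have d2_ge := sqrt_le_sqr d_ge.
  by apply: large => //; nra.
Qed.
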